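(* Let $\boldsymbol\theta$ be a torsion-free directive sequence defined on a sequence of alphabets of bounded size, with length sequence $(q_n)_{n\ge0}$. Then $h_{\rm comb}(\boldsymbol\theta)=h(\boldsymbol\theta)$, i.e. the combinatorial height of $\boldsymbol\theta$ equals its height.
   Context: Alphabets are finite sets. A morphism $\theta:\mathcal A\to\mathcal B^+$ maps letters to non-empty words and is extended by concatenation to words and to $\mathcal A^{\mathbb Z}$ (with $\theta(x_0)$ starting at index $0$). $\sigma$ is the left shift. A directive sequence is a sequence $\boldsymbol\theta=(\theta^{(n)})_{n\ge 0}$ of morphisms $\theta^{(n)}:\mathcal A_{n+1}\to\mathcal A_n^+$; bounded size means $\sup_n|\mathcal A_n|<\infty$. Put $\theta^{[n,N)}=\theta^{(n)}\circ\cdots\circ\theta^{(N-1)}$. $X^{(n)}_{\boldsymbol\theta}=X^{(n)}$ is the set of $x\in\mathcal A_n^{\mathbb Z}$ all of whose finite subwords are subwords of $\theta^{[n,N)}(a)$ for some $N>n$ and $a\in\mathcal A_N$; $X_{\boldsymbol\theta}=X^{(0)}_{\boldsymbol\theta}$. $\boldsymbol\theta$ is constant-length with length sequence $(q_n)$ if $|\theta^{(n)}(a)|=q_n$ for all $n$ and all $a\in\mathcal A_{n+1}$. $\boldsymbol\theta$ is injective if each $\theta^{(n)}$ is injective on letters. $\boldsymbol\theta$ is torsion-free if it is constant-length with length sequence $(q_n)$, $q_n>1$ for infinitely many $n$, each $(X^{(n)}_{\boldsymbol\theta},\sigma)$ is minimal, $X^{(0)}_{\boldsymbol\theta}$ is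 aperiodic (contains no $\sigma$-periodic point), and every prime dividing some $q_k$ divides $q_n$ for infinitely many $n$. Height: if $\boldsymbol\theta$ is torsion-free on alphabets of bounded size, its maximal equicontinuous factor is the rotation by $(1,1)$ on $\mathbb Z_{(q_n)}\times\mathbb Z/h\mathbb Z$ for some $h$ coprime to every $q_n$, where $\mathbb Z_{(q_n)}=\varprojlim\mathbb Z/(q_0\cdots q_{n-1})\mathbb Z$; $h(\boldsymbol\theta)=h$ is the height. Injectivisation $\widehat{\boldsymbol\theta}$ of $\boldsymbol\theta$: let $\mathcal B_0=\mathcal A_0$, $\tau_0=\mathrm{id}$. Recursively, put $\eta^{(n)}=\tau_n\circ\theta^{(n)}:\mathcal A_{n+1}\to\mathcal B_n^{q_n}$ ($\tau_n$ applied letterwise), let $\tau_{n+1}:\mathcal A_{n+1}\to\mathcal B_{n+1}$ be the quotient map identifying $a,a'$ exactly when $\eta^{(n)}(a)=\eta^{(n)}(a')$, and let $\widehat\theta^{(n)}:\mathcal B_{n+1}\to\mathcal B_n^{q_n}$ be given by $\widehat\theta^{(n)}(b)=\eta^{(n)}(a)$ for any $a\in\tau_{n+1}^{-1}(b)$. Then $\widehat{\boldsymbol\theta}=(\widehat\theta^{(n)})_{n\ge 0}$ is injective with $X_{\widehat{\boldsymbol\theta}}=X_{\boldsymbol\theta}$. Combinatorial height: for injective $\boldsymbol\theta$, fix a limit word, i.e. a sequence $(u^{(n)})_{n\ge0}$ with $u^{(n)}\in X^{(n)}$ and $\theta^{(n)}(u^{(n+1)})=u^{(n)}$ for all $n$,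 and set $$h^{(n)}(\boldsymbol\theta)=\max\{d\ge1:\ \gcd(d,q_N)=1\ \text{for all }N\ge n,\ \ d\mid\gcd\{k:u^{(n)}_k=u^{(n)}_0\}\}.$$ If $\boldsymbol\theta$ is not injective, $h^{(n)}(\boldsymbol\theta):=h^{(n)}(\widehat{\boldsymbol\theta})$. For torsion-free $\boldsymbol\theta$ on alphabets of bounded size the sequence $(h^{(n)}(\boldsymbol\theta))_n$ is bounded, and $h_{\rm comb}(\boldsymbol\theta):=\max\{h^{(n)}(\boldsymbol\theta):n\ge0\}$. *)

(* Defs.v *)
From mathcomp Require Import all_boot all_order all_algebra.
From mathcomp Require Import all_classical.
From mathcomp Require Import topology.

Set Implicit Arguments.
Unset Strict Implicit.
Unset Printing Implicit Defensive.

Local Open Scope classical_set_scope.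

(** * Topological dynamical systems *)

(* A system is the restriction of [act] to the subset [carrier] of a uniform
   space.  The conditions making it a compact system are in [dynamical]. *)
Record system := System {
  phase : uniformType;
  carrier : set phase;
  act : phase -> phase }.

Arguments carrier : clear implicits.
Arguments act : clear implicits.

Definition dynamical (S : system) : Prop :=
  [/\ hausdorff_space (phase S),
      compact (carrier S),
      carrier S !=set0,
      {within carrier S, continuous (act S)}
    & set_bij (carrier S) (carrier S) (act S)].

Definition minimal (S : system) : Prop :=
  carrier S !=set0 /\
  forall C : set (phase S), closed C -> C `<=` carrier S -> C !=set0 ->
    act S @` C `<=` C -> C = carrier S.

Definition aperiodic (S : system) : Prop :=
  forall x, carrier S x -> forall p, (0 < p)%N -> iter p (act S) x <> x.

(* (Uniform) equicontinuity of the integer powers of [act]; since [act] is a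
   bijection of the carrier, the last clause is about the powers of exponent
   [- n]. *)
Definition equicontinuous_system (S : system) : Prop :=
  forall E : set (phase S * phase S), entourage E ->
  exists2 F : set (phase S * phase S), entourage F &
    forall x y, carrier S x -> carrier S y -> forall n,
      (F (x, y) -> E (iter n (act S) x, iter n (act S) y)) /\
      (F (iter n (act S) x, iter n (act S) y) -> E (x, y)).

Definition factor_map (S S' : system) (p : phase S -> phase S') : Prop :=
  [/\ {within carrier S, continuous p},
      p @` carrier S = carrier S'
    & forall x, carrier S x -> p (act S x) = act S' (p x)].

Definition maximal_equicontinuous_factor (S Z : system) : Prop :=
  [/\ dynamical Z, equicontinuous_system Z &
      exists2 p : phase S -> phase Z, factor_map p &
        forall (Y : system) (f : phase S -> phase Y),
          dynamical Y -> equicontinuous_system Y -> factor_map f ->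
          exists2 g : phase Z -> phase Y, factor_map g &
            forall x, carrier S x -> f x = g (p x)].

(** * Directive sequences and their shifts *)

Record directive := Directive {
  alphabet : nat -> finType;
  morph : forall n, alphabet n.+1 -> seq (alphabet n);
  morph_neq0 : forall n a, @morph n a != [::] }.

(* [block D n k] is the composition of the morphisms of indices
   n, ..., k + n - 1. *)
Fixpoint block (D : directive) (n k : nat) :
    alphabet D (k + n) -> seq (alphabet D n) :=
  if k is k'.+1 return alphabet D (k + n) -> seq (alphabet D n)
  then fun a => flatten [seq block b | b <- @morph D (k' + n) a]
  else fun a => [:: a].

Definition window (T : Type) (x : int -> T) (i : int) (l : nat) : seq T :=
  [seq x (i + j%:Z)%R | j <- iota 0 l].

Definition shift (T : Type) (x : int -> T) : int -> T := fun i => x (i + 1)%R.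

Definition level_set (D : directive) (n : nat) : set (int -> alphabet D n) :=
  [set x | forall i l, exists k (a : alphabet D (k + n)),
     (0 < k)%N /\ infix (window x i l) (block a)].

Definition level_system (D : directive) (n : nat) : system :=
  @System (prod_topology (fun _ : int => discrete_topology (alphabet D n)))
    (@level_set D n) (@shift (alphabet D n)).

Definition bounded_size (D : directive) : Prop :=
  exists K : nat, forall n, (#|alphabet D n| <= K)%N.

Definition constant_length (D : directive) (q : nat -> nat) : Prop :=
  forall n (a : alphabet D n.+1), size (morph a) = q n.

Definition injective_directive (D : directive) : Prop :=
  forall n, injective (@morph D n).

Definition torsion_free (D : directive) (q : nat -> nat) : Prop :=
  [/\ constant_length D q,
      forall m, exists2 n, (m <= n)%N & (1 < q n)%N,
      forall n, minimal (level_system D n),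
      aperiodic (level_system D 0)
    & forall p k, prime p -> p %| q k ->
        forall m, exists2 n, (m <= n)%N & p %| q n].

(** * Height *)

Definition prodq (q : nat -> nat) (n : nat) : nat := (\prod_(i < n) q i)%N.

(* Z/m is represented by 'I_m, where [ordS] is the translation by 1. *)
Definition odometer (q : nat -> nat) (h : nat) : system :=
  @System
    (prod_topology (fun n : nat => discrete_topology 'I_(prodq q n))
       * discrete_topology 'I_h)%type
    [set z | forall n, (z.1 n.+1 : 'I__) %% prodq q n = (z.1 n : 'I__) :> nat]
    (fun z => (fun n => ordS (z.1 n), ordS z.2)).

Definition is_height (D : directive) (q : nat -> nat) (h : nat) : Prop :=
  [/\ (0 < h)%N, forall n, coprime h (q n)
    & maximal_equicontinuous_factor (level_system D 0) (odometer q h)].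

(** * Injectivisation *)

(* The n-th alphabet together with the projection onto it of the n-th alphabet
   of D.  The quotient of [alphabet D n.+1] by the kernel of the letterwise
   image of [morph] is realised as the image of that map. *)
Fixpoint inj_data (D : directive) (n : nat) :
    {B : finType & alphabet D n -> B} :=
  if n is m.+1 return {B : finType & alphabet D n -> B} then
    let eta := fun a : alphabet D m.+1 =>
      map (projT2 (inj_data D m)) (morph a) in
    existT (fun B : finType => alphabet D m.+1 -> B)
      (seq_sub (codom eta)) (fun a => SeqSub (codom_f eta a))
  else existT (fun B : finType => alphabet D 0 -> B) (alphabet D 0) id.

Definition inj_alphabet (D : directive) (n : nat) : finType :=
  projT1 (inj_data D n).

Definition inj_morph (D : directive) (n : nat) :
    inj_alphabet D n.+1 -> seq (inj_alphabet D n) := fun b => ssval b.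

Lemma inj_morph_neq0 (D : directive) (n : nat) (b : inj_alphabet D n.+1) :
  inj_morph b != [::].
Proof.
rewrite /inj_morph; have /codomP[a ->] := ssvalP b.
by rewrite -size_eq0 size_map size_eq0 morph_neq0.
Qed.

Definition injectivisation (D : directive) : directive :=
  Directive (@inj_morph_neq0 D).

Definition injective_version (D : directive) : directive :=
  if pselect (injective_directive D) then D else injectivisation D.

(** * Combinatorial height *)

(* [y] is the image of [x] under [f], where [f (x 0)] starts at index 0 and
   [f (x i)] starts at index [pos i]. *)
Definition morphism_image (A B : Type) (f : A -> seq B)
    (x : int -> A) (y : int -> B) : Prop :=
  exists2 pos : int -> int, pos 0%R = 0%R &
    forall i, pos (i + 1)%R = (pos i + (size (f (x i)))%:Z)%R /\
      window y (pos i) (size (f (x i))) = f (x i).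

Definition limit_word (D : directive) (u : forall n, int -> alphabet D n) :
    Prop :=
  forall n, level_set (u n) /\ morphism_image (@morph D n) (u n.+1) (u n).

Definition is_gcd (S : set int) (g : nat) : Prop :=
  (forall k, S k -> (g %| k)%Z) /\
  forall d : nat, (forall k, S k -> (d %| k)%Z) -> d %| g.

Definition is_max (S : set nat) (m : nat) : Prop :=
  S m /\ forall d, S d -> (d <= m)%N.

Definition is_level_height (D : directive) (q : nat -> nat)
    (u : forall n, int -> alphabet D n) (n d : nat) : Prop :=
  is_max [set d | [/\ (1 <= d)%N,
                      forall N, (n <= N)%N -> coprime d (q N)
                    & exists2 g, is_gcd [set k | u n k = u n 0%R] g & d %| g]]
         d.

Definition is_combinatorial_height (D : directive) (q : nat -> nat)
    (u : forall n, int -> alphabet (injective_version D) n) (h : nat) : Prop :=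
  exists2 hn : nat -> nat, forall n, is_level_height q u n (hn n) &
    is_max (range hn) h.

(* Main.v *)
Require Import Defs.
From mathcomp Require Import all_boot all_order all_algebra.
From mathcomp Require Import all_classical.
From mathcomp Require Import topology.
From mathcomp Require Import zify.

(** The maximal equicontinuous factor [p : X -> Z_(q_n) x Z/h] supplies by itself
    the recognizability that the argument needs.  Let [Q_n = q_0 ... q_(n-1)].

    If [d] is prime to all [q_k] and divides all [k] with [u^(n)_k = u^(n)_0], let
    [U] be the set of [x] in [X] that agree with [u^(0)] on [[0, Q_n)] and have the
    same image as [u^(0)] in [Z/Q_n].  The orbit of [u^(0)] visits [U] only at times
    [k Q_n] with [u^(n)_k = u^(n)_0], hence at multiples of [d], so [X] factors onto
    the rotation on [Z/d].  This factor passes through [p], and the translations by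
    [Q_m h] tend to the identity on [Z_(q_n) x Z/h], so [d] divides [Q_m h] for
    large [m], hence divides [h].

    Conversely, the coordinate [X -> Z/h] is constant on a cylinder around [u^(0)],
    to which [u^(0)] returns.  For large [n] the window of such a return lies inside
    the block [[0, Q_n)], which reappears at [k Q_n] when [u^(n)_k = u^(n)_0]; thus
    [h] divides [k Q_n], hence [k]. *)

Set Implicit Arguments.
Unset Strict Implicit.
Unset Printing Implicit Defensive.

Import Order.TTheory GRing.Theory Num.Theory.

Local Open Scope classical_set_scope.

(** * Products of discrete spaces and maps into discrete spaces *)

(** The supersets of cylinders around [x] form a filter [F]. The product topology is a supremum, so
    convergence of [F] to [x] is tested one coordinate at a time. The converse is a finite
    intersection of preimages under projections. *)
Lemma nbhs_prod_discrete (I : choiceType) (T : I -> choiceType)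
    (x : prod_topology (fun i => discrete_topology (T i))) (A : set _) :
  nbhs x A <-> exists s : seq I, forall y, {in s, forall i, y i = x i} -> A y.
Proof.
split.
- pose F : set_system (prod_topology (fun i => discrete_topology (T i))) :=
    [set B | exists s : seq I, forall y, {in s, forall i, y i = x i} -> B y].
  have FF : Filter F.
    split; first by exists [::].
    - move=> B C [s Bs] [t Ct]; exists (s ++ t) => y eq_yx; split.
        by apply: Bs => i si; apply: eq_yx; rewrite mem_cat si.
      by apply: Ct => i ti; apply: eq_yx; rewrite mem_cat ti orbT.
    by move=> B C BC [s Bs]; exists s => y /Bs /BC.
  suff Fx : F --> (x : prod_topology (fun i => discrete_topology (T i))).
    by move/Fx.
  apply/cvg_sup => i B [_ [[V _ <-] Vx] VB]; exists [:: i] => y eq_yx.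
  by apply: VB; rewrite /= eq_yx ?mem_head.
- pose P : topologicalType := prod_topology (fun i => discrete_topology (T i)).
  have FF : Filter (nbhs (x : P)) by exact: nbhs_filter.
  case=> s; elim: s A => [|i s IHs] A sA.
    by apply: filterS filterT => y _; exact: sA.
  have xi : nbhs x (@proj I (fun i => discrete_topology (T i)) i @^-1` [set x i]).
    exact/proj_continuous/discrete_set1.
  have xs := IHs [set y | {in s, forall i, y i = x i}] (fun y ys => ys).
  apply: filterS (filterI xi xs) => y [yi ys]; apply: sA => j.
  by rewrite inE => /predU1P[->|/ys].
Qed.

Lemma within_discrete_continuousP (U : topologicalType)
    (T : discreteTopologicalType) (A : set U) (f : U -> T) :
  {within A, continuous f} <->
  forall x, A x -> nbhs x [set y | A y -> f y = f x].
Proof.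
rewrite subspace_continuousP; split=> f_cts x Ax.
  by have := f_cts x Ax; rewrite discrete_cvg.
by rewrite discrete_cvg; exact: f_cts.
Qed.

(** * Finite rotations *)

Definition rotation (d : nat) : system :=
  @System (discrete_topology 'I_d) setT (@ordS d).

Lemma rotation_dynamical (d : nat) : (0 < d)%N -> dynamical (rotation d).
Proof.
move=> d_gt0; split=> /=.
- exact: discrete_hausdorff.
- exact/finite_compact/finite_finset.
- by exists (Ordinal d_gt0).
- apply/within_discrete_continuousP => x _.
  exact/principal_filterP.
- split=> //; first by move=> x y _ _; exact: ordS_inj.
  by move=> y _; exists (ord_pred y) => //=; exact: ord_predK.
Qed.

Lemma rotation_equicontinuous (d : nat) : equicontinuous_system (rotation d).
Proof.
move=> E entE; exists [set xy | xy.1 = xy.2].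
  by rewrite /= uniform_discrete => _ [x _ <-].
have iter_ordS_inj n : injective (iter n (@ordS d)).
  by elim: n => [|n IHn] x y //= /ordS_inj /IHn.
by move=> x y _ _ n /=; split=> [-> | /iter_ordS_inj ->]; exact: entourage_refl.
Qed.

Lemma val_iter_ordS (d a : nat) (i : 'I_d) : iter a (@ordS d) i = (i + a) %% d :> nat.
Proof.
elim: a => [|a IHa]; first by rewrite addn0 modn_small.
by rewrite iterS /= IHa -addn1 modnDml addn1 addnS.
Qed.

(** * Minimal systems and return times *)

(** The closure of the forward orbit, cut down to the carrier, is closed and stable under [act], so
    minimality makes it the whole carrier. *)
Lemma minimal_orbit_dense (S : system) (x y : phase S) (V : set (phase S)) :
  minimal S -> closed (carrier S) -> continuous (act S) ->
  act S @` carrier S `<=` carrier S ->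
  carrier S x -> carrier S y -> nbhs y V -> exists a, V (iter a (act S) x).
Proof.
move=> [_ minS] clS cts stable Sx Sy Vy.
pose C := closure (range (fun a => iter a (act S) x)) `&` carrier S.
have CS : C = carrier S.
  apply: minS => //; first by apply: closedI => //; exact: closed_closure.
  - by move=> z [].
  - by exists x; split=> //; apply: subset_closure; exists 0%N.
  - move=> _ [z [clz Sz] <-]; split; last by apply: stable; exists z.
    move=> B /cts /clz[_ [[a _ <-] Ba]].
    by exists (iter a.+1 (act S) x); split=> //; exists a.+1.
have [clCy _] : C y by rewrite CS.
by have [_ [[a _ <-] Va]] := clCy _ Vy; exists a.
Qed.

(** The image of [y] is the common residue of the times at which the orbit of [x] visits a small
    neighbourhood of [y]. If [m] steps carry [y] into the interior of [U], then visits to the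
    [m]-step preimage of [U] occur only at times congruent to -m modulo [d]. *)
Lemma return_times_factor (S : system) (d : nat) (x : phase S) (U : set (phase S)) :
  minimal S -> closed (carrier S) -> continuous (act S) ->
  act S @` carrier S `<=` carrier S ->
  carrier S x -> nbhs x U -> (0 < d)%N ->
  (forall a, U (iter a (act S) x) -> d %| a) ->
  exists2 f : phase S -> phase (rotation d),
    @factor_map S (rotation d) f &
    forall a, f (iter a (act S) x) = a %% d :> nat.
Proof.
move=> minS clS cts stable Sx Ux d_gt0 retU.
have dense := minimal_orbit_dense minS clS cts stable.
have Siter a y : carrier S y -> carrier S (iter a (act S) y).
  by move=> Sy; elim: a => //= a IHa; apply: stable; exists (iter a (act S) y).
have cts_iter m : continuous (iter m (act S)).
  elim: m => [|m IHm] y; first exact: cvg_id.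
  by apply: continuous_comp; [exact: IHm | exact: cts].
pose P (y : phase S) (r : 'I_d) := exists2 V, nbhs y V &
  forall a, V (iter a (act S) x) -> a = r %[mod d].
have exP (y : phase S) : exists r, carrier S y -> P y r.
  case: (pselect (carrier S y)) => [Sy|]; last by exists (Ordinal d_gt0).
  have [m Um] := dense _ _ _ Sy Sx (nbhs_interior Ux).
  pose V := iter m (act S) @^-1` U.
  have Vy : nbhs y V by exact: cts_iter.
  have [b Vb] := dense _ _ _ Sx Sy Vy.
  have lt_r : b %% d < d by rewrite ltn_mod.
  exists (Ordinal lt_r) => _; exists V => // a Va; rewrite /= modn_mod.
  have dvdV c : V (iter c (act S) x) -> d %| m + c.
    by rewrite /V /= -iterD => /retU.
  apply/eqP; rewrite -(eqn_modDl m).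
  by move: (dvdV _ Va) (dvdV _ Vb) => /eqP-> /eqP->.
have [f fP] := choice exP.
have f_iter a : f (iter a (act S) x) = a %% d :> nat.
  have [V /nbhs_singleton Va] := fP _ (Siter a x Sx).
  by move=> /(_ a Va) ->; rewrite modn_small.
exists f => //; split.
- apply/(@within_discrete_continuousP _ (discrete_topology 'I_d)) => y Sy.
  have [V Vy Vf] := fP y Sy; apply: filterS (nbhs_interior Vy) => z Vz Sz.
  have [W Wz Wf] := fP z Sz.
  (* A common visiting time of [V] and [W] forces the residues at [y] and [z] to agree. *)
  have [a [Va Wa]] := dense _ _ _ Sx Sz (filterI Vz Wz).
  by apply/val_inj; rewrite /= -[LHS](modn_small (ltn_ord _)) -(Wf a Wa) (Vf a Va) modn_small.
- rewrite predeqE => r; split=> // _.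
  exists (iter r (act S) x); first exact: Siter.
  by apply/val_inj; rewrite /= f_iter modn_small.
- move=> y Sy; have Say : carrier S (act S y) by apply: stable; exists y.
  have [[V Vy Vf] [W /cts Wy Wf]] := (fP y Sy, fP _ Say).
  have [a [Va Wa]] := dense _ _ _ Sx Sy (filterI Vy Wy).
  apply/val_inj; rewrite /= -[LHS](modn_small (ltn_ord _)) -(Wf a.+1 Wa).
  by rewrite -addn1 -modnDml (Vf a Va) modnDml addn1.
Qed.

(** * Iterates under factor maps and rotation factors of the odometer *)

Lemma iter_factor (S S' : system) (p : phase S -> phase S') (x : phase S) (a : nat) :
  act S @` carrier S `<=` carrier S -> factor_map p -> carrier S x ->
  p (iter a (act S) x) = iter a (act S') (p x).
Proof.
move=> stable [_ _ p_act] Sx.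
have Siter b : carrier S (iter b (act S) x).
  by elim: b => //= b IHb; apply: stable; exists (iter b (act S) x).
by elim: a => //= a IHa; rewrite p_act // IHa.
Qed.

Lemma dvdn_prodq (q : nat -> nat) (m n : nat) : m <= n -> prodq q m %| prodq q n.
Proof.
by move=> /subnKC <-; rewrite /prodq big_split_ord /= dvdn_mulr.
Qed.

Lemma prodq_unbounded (q : nat -> nat) (b : nat) :
  (forall n, 0 < q n) -> (forall m, exists2 n, m <= n & 1 < q n) ->
  exists n, b < prodq q n.
Proof.
move=> q_gt0 q_gt1; elim: b => [|b [m bm]]; first by exists 0%N; rewrite /prodq big_ord0.
have [n mn qn] := q_gt1 m; exists n.+1.
have : prodq q m <= prodq q n by rewrite dvdn_leq ?dvdn_prodq // prodn_gt0.
by rewrite [prodq q n.+1]big_ord_recr -/(prodq q n) /=; nia.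
Qed.

Lemma iter_odometer (q : nat -> nat) (h a : nat) (z : phase (odometer q h)) :
  iter a (act (odometer q h)) z =
    (fun n => iter a (@ordS _) (z.1 n), iter a (@ordS _) z.2).
Proof. by elim: a => [|a IHa]; rewrite ?iterS ?IHa //=; case: z. Qed.

Lemma odometer_rotation_factor (q : nat -> nat) (h d : nat)
    (g : phase (odometer q h) -> phase (rotation d)) z :
  @factor_map (odometer q h) (rotation d) g -> carrier (odometer q h) z ->
  (forall n, coprime d (prodq q n)) -> d %| h.
Proof.
move=> fg Cz co_d.
have stable : act (odometer q h) @` carrier (odometer q h) `<=` carrier (odometer q h).
  move=> _ [y Cy <-] n /=; rewrite modn_dvdm ?dvdn_prodq //.
  by rewrite -addn1 -modnDml Cy addn1.
have [g_cts _ _] := fg.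
have Citer a : carrier (odometer q h) (iter a (act (odometer q h)) z).
  by elim: a => [//|a IHa]; apply: stable; exists (iter a (act (odometer q h)) z).
have [[A B] /= [Az Bz] AB] : nbhs z [set y | carrier (odometer q h) y -> g y = g z].
  exact: (@within_discrete_continuousP _ (discrete_topology 'I_d) _ _).1.
have [s As] := (nbhs_prod_discrete _ _).1 Az.
(* The neighbourhood [A] constrains only coordinates up to [m]. Translation by [a] fixes these, as
   [prodq q m] divides [a], and also the [Z/h] coordinate. *)
pose m := \max_(i <- s) i; pose a := prodq q m * h.
suff : d %| a by rewrite Gauss_dvdr.
have : g (iter a (act (odometer q h)) z) = g z.
  apply: AB (Citer a); rewrite iter_odometer; split.
    apply: As => n sn; apply/val_inj; rewrite /= val_iter_ordS.
    rewrite -modnDmr /a (eqP (dvdn_mulr _ (dvdn_prodq _ _))) ?addn0 ?modn_small //.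
    exact: leq_bigmax_seq.
  have -> : iter a (@ordS _) z.2 = z.2.
    by apply/val_inj; rewrite /= val_iter_ordS /a -modnDmr modnMl addn0 modn_small.
  exact: nbhs_singleton Bz.
rewrite (iter_factor _ stable fg Cz) => /(congr1 val) /=.
rewrite val_iter_ordS => /eqP; rewrite -{2}(modn_small (ltn_ord (g z))).
by rewrite -{2}[val (g z)]addn0 eqn_modDl mod0n.
Qed.

(** * The level shifts *)

Lemma iter_shift (T : Type) (a : nat) (x : int -> T) (i : int) :
  iter a (@shift T) x i = x (i + a%:Z)%R.
Proof.
elim: a x i => [|a IHa] x i; first by rewrite addr0.
by rewrite iterS /shift IHa -addrA -[in RHS]addn1 PoszD [(1 + _)%R]addrC.
Qed.

Lemma level_set_translate (D : directive) (n : nat) (x : int -> alphabet D n) (k : int) :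
  level_set x -> level_set (fun i => x (i + k)%R).
Proof.
move=> Xx i l; have [m [a [m_gt0 xa]]] := Xx (i + k)%R l.
exists m, a; split=> //; congr (infix _ _): xa.
by apply: eq_map => j; rewrite addrAC.
Qed.

Lemma level_set_stable (D : directive) (n : nat) :
  act (level_system D n) @` carrier (level_system D n) `<=` carrier (level_system D n).
Proof. by move=> _ [x Xx <-]; exact: level_set_translate. Qed.

Lemma level_set_closed (D : directive) (n : nat) : closed (carrier (level_system D n)).
Proof.
move=> x clx i l; pose s := [seq (i + j%:Z)%R | j <- iota 0 l].
have [y [Xy yx]] := clx [set y | {in s, forall i, y i = x i}]
  ((nbhs_prod_discrete (T := fun=> alphabet D n) _ _).2 (ex_intro _ s (fun y ys => ys))).
have [m [a [m_gt0 ya]]] := Xy i l; exists m, a; split=> //; congr (infix _ _): ya.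
by apply/eq_in_map => j jl; apply: yx; exact: map_f.
Qed.

Lemma shift_continuous (D : directive) (n : nat) : continuous (act (level_system D n)).
Proof.
move=> x V /(nbhs_prod_discrete (T := fun=> alphabet D n))[s sV].
apply/(nbhs_prod_discrete (T := fun=> alphabet D n)).
exists [seq (i + 1)%R | i <- s] => y ys; apply: sV => i si.
by apply: ys; exact: map_f.
Qed.

Lemma level_orbit_dense (D : directive) (n : nat) (x y : int -> alphabet D n) (s : seq int) :
  minimal (level_system D n) -> level_set x -> level_set y ->
  exists a : nat, {in s, forall i, x (i + a%:Z)%R = y i}.
Proof.
move=> minX Xx Xy.
have ys : nbhs (y : phase (level_system D n)) [set z | {in s, forall i, z i = y i}].
  by apply/(nbhs_prod_discrete (T := fun=> alphabet D n)); exists s.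
have [a xa] := minimal_orbit_dense minX (@level_set_closed D n)
  (@shift_continuous D n) (@level_set_stable D n) Xx Xy ys.
by exists a => i si; rewrite -iter_shift; exact: xa.
Qed.

(** * Limit words and their blocks at level 0 *)

Lemma morphism_image_window (A B : Type) (f : A -> seq B) (l : nat) x y :
  (forall a, size (f a) = l) -> morphism_image f x y ->
  forall i, window y (i * l%:Z)%R l = f (x i).
Proof.
move=> size_f [pos pos0 pos_spec] i; suff <- : pos i = (i * l%:Z)%R.
  by rewrite -[in LHS](size_f (x i)) (pos_spec i).2.
have pos_succ j : pos (j + 1)%R = (pos j + l%:Z)%R by rewrite (pos_spec j).1 size_f.
elim/int_rect: i => [|n IHn|n IHn]; first by rewrite pos0 mul0r.
  by rewrite -addn1 PoszD pos_succ IHn mulrDl mul1r.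
have := pos_succ (- n.+1%:Z)%R.
have -> : (- n.+1%:Z + 1 = - n%:Z)%R by lia.
rewrite IHn; lia.
Qed.

(** Induction on [n]: a letter of level [n.+1] is determined by its [q n] letters of level [n],
    since [morph] is injective, and each of these by its block of length [prodq q n]. The offset [t]
    splits by division by that length. *)
Lemma limit_word_blocks (E : directive) (q : nat -> nat)
    (u : forall n, int -> alphabet E n) (n : nat) (i j : int) :
  constant_length E q -> injective_directive E -> limit_word u ->
  u n i = u n j <->
  forall t, t < prodq q n ->
    u 0%N (i * (prodq q n)%:Z + t%:Z)%R = u 0%N (j * (prodq q n)%:Z + t%:Z)%R.
Proof.
move=> lenE injE limu; elim: n i j => [|n IHn] i j.
  rewrite /prodq big_ord0 !mulr1; split=> [uij [|//] _|uij]; first by rewrite !addr0.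
  by have := uij 0%N isT; rewrite !addr0.
have win := morphism_image_window (lenE n) (limu n).2.
have -> : prodq q n.+1 = q n * prodq q n by rewrite [LHS]big_ord_recr mulnC.
rewrite PoszM; set Q := prodq q n in IHn *.
split=> [uij t tlt|uij].
  have Q_gt0 : 0 < Q by move: tlt; lia.
  have := win i; rewrite uij -(win j) => /eq_in_map/(_ (t %/ Q)).
  rewrite mem_iota ltn_divLR // => /(_ tlt)/IHn/(_ (t %% Q)).
  rewrite ltn_mod => /(_ Q_gt0).
  rewrite !mulrDl -!addrA -!PoszM -!PoszD -divn_eq -!mulrA //.
apply: (injE n); rewrite -!win; apply/eq_in_map => t; rewrite mem_iota => /= tq.
apply/IHn => s sQ; rewrite !mulrDl -!mulrA -!addrA -!PoszM -!PoszD.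
apply: uij; nia.
Qed.

(** * The two divisibilities between height and return times *)

(** Here [v] is the level-0 limit word. The equality of letters of level [n] at [k] and 0 is
    expressed by blocks of [v], so that only [D] itself is involved and not its injectivisation. *)
Lemma prodq_multiple_dvd_height (D : directive) (q : nat -> nat) (h n d : nat)
    (v : int -> alphabet D 0) :
  minimal (level_system D 0) -> is_height D q h -> (0 < prodq q n) -> level_set v ->
  (0 < d) -> (forall m, coprime d (prodq q m)) ->
  (forall k : int,
     (forall t, t < prodq q n -> v (k * (prodq q n)%:Z + t%:Z)%R = v (Posz t)) -> d %| absz k) ->
  d %| h.
Proof.
move=> minX [h_gt0 _ [_ _ [p p_factor p_univ]]] Q_gt0 Xv d_gt0 co_d retv.
have [p_cts p_img p_act] := p_factor.
set Q := prodq q n in Q_gt0 retv.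
have Cpv : carrier (odometer q h) (p v) by rewrite -p_img; exists v.
pose U : set (phase (level_system D 0)) :=
  [set x | level_set x -> (p x).1 n = (p v).1 n] `&`
  [set x | {in [seq Posz t | t <- iota 0 Q], forall i, x i = v i}].
have Uv : nbhs (v : phase (level_system D 0)) U.
  apply: filterI; last first.
    by apply/(nbhs_prod_discrete (T := fun=> alphabet D 0)); exists [seq Posz t | t <- iota 0 Q].
  have := (@subspace_continuousP _ _ _ p).1 p_cts v Xv.
  move=> /(_ [set z | z.1 n = (p v).1 n]); apply.
  exists ([set z | z n = (p v).1 n], setT); last by move=> z [].
  split; last exact: filterT.
  apply/(nbhs_prod_discrete (T := fun n => 'I_(prodq q n))); exists [:: n] => y yz.
  by rewrite /= yz ?mem_head.
have [f f_factor f_iter] : exists2 f : phase (level_system D 0) -> phase (rotation d),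
    @factor_map (level_system D 0) (rotation d) f &
    forall a, f (iter a (act (level_system D 0)) v) = a %% d :> nat.
  apply: return_times_factor Uv d_gt0 _ => //.
  - exact: level_set_closed.
  - exact: shift_continuous.
  - exact: level_set_stable.
  move=> a [pa va].
  (* Recognizability: the shift adds 1 to the coordinate of [p] in [Z/Q], and this coordinate is the
     same at times 0 and [a]. *)
  have /dvdnP[k ak] : Q %| a.
    have Xa : level_set (iter a (act (level_system D 0)) v).
      rewrite (_ : iter _ _ _ = fun i => v (i + a%:Z)%R); first exact: level_set_translate.
      by apply/funext => i; exact: iter_shift.
    have := pa Xa; rewrite (iter_factor _ (@level_set_stable D 0) p_factor Xv) iter_odometer.
    move=> /(congr1 val) /=; rewrite val_iter_ordS => /eqP.
    rewrite -{2}(modn_small (ltn_ord ((p v).1 n))).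
    by rewrite -{2}[val ((p v).1 n)]addn0 eqn_modDl mod0n.
  rewrite ak dvdn_mulr //; apply: (retv (Posz k)) => t tQ.
  rewrite -PoszM -ak -[RHS]va; first by rewrite iter_shift addrC.
  by apply: map_f; rewrite mem_iota /=.
have [g g_factor _] := p_univ _ _ (rotation_dynamical d_gt0)
  (@rotation_equicontinuous d) f_factor.
exact: odometer_rotation_factor g_factor Cpv co_d.
Qed.

Lemma height_dvd_prodq_multiples (D : directive) (q : nat -> nat) (h : nat)
    (v : int -> alphabet D 0) :
  minimal (level_system D 0) -> is_height D q h ->
  (forall b, exists n, b < prodq q n) -> level_set v ->
  exists n, forall k : int,
    (forall t, t < prodq q n -> v (k * (prodq q n)%:Z + t%:Z)%R = v (Posz t)) -> h %| absz k.
Proof.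
move=> minX [h_gt0 co_h [_ _ [p p_factor _]]] q_unb Xv.
have [p_cts _ _] := p_factor.
have [s sv] : exists s : seq int, forall x, level_set x ->
    {in s, forall i, x i = v i} -> (p x).2 = (p v).2.
  have pv : nbhs (v : phase (level_system D 0))
      [set x | level_set x -> (p x).2 = (p v).2].
    have := (@subspace_continuousP _ _ _ p).1 p_cts v Xv.
    move=> /(_ [set z | z.2 = (p v).2]); apply.
    exists (setT, [set (p v).2]); last by move=> z [].
    by split; [exact: filterT | exact/principal_filterP].
  have [s sV] := (nbhs_prod_discrete (T := fun=> alphabet D 0) _ _).1 pv.
  by exists s => x Xx xs; exact: sV.
pose L := \max_(i <- s) absz i.
have sL i : i \in s -> absz i <= L by move=> si; exact: (leq_bigmax_seq (F := absz)).
(* The indices in [s] may be negative. Starting from the translate by [L] gives a return at time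
   [L + b], whose window then lies in [[0, L + b + L]]. *)
have [b vb] := level_orbit_dense s minX (level_set_translate (Posz L) Xv) Xv.
have [n nQ] := q_unb (L + b + L); exists n => k.
set Q := prodq q n in nQ * => vk.
have p2 a (x : int -> alphabet D 0) : level_set x ->
    (p (fun i => x (i + a%:Z)%R)).2 = ((p x).2 + a) %% h :> nat.
  move=> Xx; have -> : (fun i => x (i + a%:Z)%R) = iter a (act (level_system D 0)) x.
    by apply/funext => i; rewrite iter_shift.
  by rewrite (iter_factor _ (@level_set_stable D 0) p_factor Xx) iter_odometer /= val_iter_ordS.
pose x := fun i => v (i + k * Q%:Z)%R.
have Xx : level_set x by exact: level_set_translate.
(* Shifted by [L + b], both [v] and [x] lie in the cylinder over [s]: the window of the return is
   inside the block [[0, Q)], which [x] shares with [v]. *)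
have pxv : ((p x).2 + (L + b)) %% h = ((p v).2 + (L + b)) %% h.
  have vs : {in s, forall i, v (i + (L + b)%:Z)%R = v i}.
    by move=> i si; rewrite -[RHS](vb i si); congr v; lia.
  have xs : {in s, forall i, x (i + (L + b)%:Z)%R = v i}.
    move=> i si; have iL := sL _ si; rewrite -[RHS](vs i si) /x.
    have -> : (i + (L + b)%:Z = (absz (i + (L + b)%:Z))%:Z)%R by lia.
    by rewrite addrC vk //; lia.
  rewrite -!p2 //; congr (nat_of_ord _).
  by rewrite (sv _ (level_set_translate _ Xx) xs) (sv _ (level_set_translate _ Xv) vs).
have {}pxv : (p x).2 = (p v).2.
  by apply/val_inj/eqP; move/eqP: pxv; rewrite eqn_modDr !modn_small.
suff hkQ : h %| absz (k * Q%:Z)%R.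
  move: hkQ; rewrite abszM absz_nat Gauss_dvdl //.
  by rewrite /Q /prodq; apply: (big_ind (coprime h)) => [|a c ha hc|i _]; rewrite ?coprimen1 ?coprimeMr ?ha ?hc.
have dvd_of_eq a (y z : int -> alphabet D 0) : level_set y -> (fun i => y (i + a%:Z)%R) = z ->
    (p y).2 = (p z).2 -> h %| a.
  move=> Xy yz pyz; have := p2 a y Xy; rewrite yz -pyz => /eqP.
  rewrite -[in X in X == _](modn_small (ltn_ord (p y).2)).
  by rewrite -[in X in X == _ %[mod _]](addn0 (p y).2) eqn_modDl mod0n eq_sym.
(* Only forward iterates are available, so for negative [k] the orbit is followed from [x] to
   [v]. *)
case: (leP 0%R (k * Q%:Z)%R) => kQ.
  by apply: (dvd_of_eq _ v x) => //; apply/funext => i; rewrite /x; congr v; lia.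
by apply: (dvd_of_eq _ x v) => //; apply/funext => i; rewrite /x; congr v; lia.
Qed.

(** * Injectivisation *)

Lemma inj_data_surjective (D : directive) (n : nat) (b : inj_alphabet D n) :
  exists a, projT2 (inj_data D n) a = b.
Proof.
case: n b => [|n] b; first by exists b.
case: b => s s_in; have /codomP[a sa] := s_in.
by exists a; apply: val_inj; rewrite /= sa.
Qed.

Lemma block_injectivisation (D : directive) (n k : nat) (a : alphabet D (k + n)) :
  @block (injectivisation D) n k (projT2 (inj_data D (k + n)) a) =
    map (projT2 (inj_data D n)) (block a).
Proof.
elim: k a => [//|k IHk] a /=.
rewrite map_flatten -!map_comp; congr flatten.
by apply: eq_map => b /=; exact: IHk.
Qed.

Lemma constant_length_injectivisation (D : directive) (q : nat -> nat) :
  constant_length D q -> constant_length (injectivisation D) q.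
Proof.
move=> lenD n b; have [a <-] := @inj_data_surjective D n.+1 b.
by rewrite /= size_map lenD.
Qed.

(** The map [r] transports letters between level-0 alphabets that coincide only after deciding
    whether [D] is injective; it is the identity in both cases. *)
Lemma injective_version_spec (D : directive) (q : nat -> nat) :
  constant_length D q ->
  [/\ constant_length (injective_version D) q,
      injective_directive (injective_version D) &
      exists2 r : alphabet (injective_version D) 0 -> alphabet D 0,
        injective r & forall x, level_set x -> level_set (r \o x)].
Proof.
move=> lenD; rewrite /injective_version; case: pselect => [injD|ninjD] /=.
  by split=> //; exists id => //; move=> x.
split; first exact: constant_length_injectivisation.
  by move=> n; exact: val_inj.
exists id => // x Xx i l; have [k [b [k_gt0 xb]]] := Xx i l.
have [a ab] := inj_data_surjective b; exists k, a; split=> //.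
by move: xb; rewrite -ab block_injectivisation map_id.
Qed.

(** * Greatest common divisors and the equality of heights *)

(** If [S] has no nonzero element the gcd is 0. Otherwise let [g] be the largest common divisor; for
    any common divisor [d], [lcmn g d] is again one, hence equals [g]. *)
Lemma is_gcd_exists (S : set int) : exists g, is_gcd S g.
Proof.
have [[k0 [Sk0 k0_neq0]]|S0] := pselect (exists k, S k /\ k != 0%R); last first.
  exists 0%N; split=> [k Sk|d _]; last exact: dvdn0.
  by rewrite dvd0z; apply: contrapT => /negP k_neq0; apply: S0; exists k.
pose common d := `[< forall k, S k -> d %| absz k >].
have common1 : exists d, common d by exists 1%N; apply/asboolP => k _; exact: dvd1n.
have common_le d : common d -> d <= absz k0.
  by move=> /asboolP/(_ k0 Sk0) dk0; rewrite dvdn_leq // absz_gt0.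
have common_gt0 d : common d -> 0 < d.
  by move=> /asboolP/(_ k0 Sk0); case: d => //; rewrite dvd0n absz_eq0 (negPf k0_neq0).
case: (ex_maxnP common1 common_le) => g cg g_max.
exists g; split=> [|d dS]; first exact/asboolP.
have c_lcm : common (lcmn g d).
  apply/asboolP => k Sk; rewrite dvdn_lcm (asboolP _ cg) //=; exact: dS.
have -> : g = lcmn g d; last exact: dvdn_lcmr.
apply/eqP; rewrite eqn_leq g_max // andbT.
by rewrite dvdn_leq ?dvdn_lcml // common_gt0.
Qed.

Theorem theorem40 (D : directive) (q : nat -> nat)
  (bounded_D : bounded_size D) (torsion_free_D : torsion_free D q)
  (u : forall n, int -> alphabet (injective_version D) n)
  (limit_u : limit_word u)
  (h : nat) (height_h : is_height D q h) :
  is_combinatorial_height q u h.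
Proof.
have [lenD q_gt1 minD _ q_recurs] := torsion_free_D.
have minX := minD 0%N.
have [lenE injE [r r_inj rX]] := injective_version_spec lenD.
have Xv := rX _ (limit_u 0%N).1.
have [h_gt0 co_h _] := height_h.
have q_gt0 n : 0 < q n.
  have [[x _] _] := minD n.+1.
  by rewrite -(lenD n (x 0%R)) lt0n size_eq0 morph_neq0.
have Q_gt0 n : 0 < prodq q n by exact: prodn_gt0.
have Q_unb b := prodq_unbounded b q_gt0 q_gt1.
have return_v n k : u n k = u n 0%R <->
    forall t, t < prodq q n ->
      (r \o u 0%N) (k * (prodq q n)%:Z + t%:Z)%R = (r \o u 0%N) (Posz t).
  rewrite (limit_word_blocks n k 0%R lenE injE limit_u); split=> uk t tQ.
    by rewrite /= uk // mul0r add0r.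
  by rewrite mul0r add0r; apply: r_inj; exact: uk.
(* By torsion-freeness, a prime dividing [d] and some [q k] would divide some [q N] with
   [n <= N]. *)
have co_prodq n d : (forall N, n <= N -> coprime d (q N)) ->
    forall m, coprime d (prodq q m).
  move=> co_d m; apply: (big_ind (coprime d)) => [|a c da dc|k _].
  - exact: coprimen1.
  - by rewrite coprimeMr da dc.
  rewrite /coprime; apply: contraT => d_qk.
  have g_gt0 : 0 < gcdn d (q k) by rewrite gcdn_gt0 q_gt0 orbT.
  have g_gt1 : 1 < gcdn d (q k) by move: d_qk g_gt0; lia.
  have := pdiv_dvd (gcdn d (q k)); rewrite dvdn_gcd => /andP[pd pq].
  have [N nN pN] := q_recurs _ _ (pdiv_prime g_gt1) pq n.
  have : pdiv (gcdn d (q k)) %| gcdn d (q N) by rewrite dvdn_gcd pd.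
  by rewrite (eqP (co_d N nN)) dvdn1; have := prime_gt1 (pdiv_prime g_gt1); lia.
pose candidate n : set nat := [set d | [/\ (1 <= d)%N,
    forall N, (n <= N)%N -> coprime d (q N)
    & exists2 g, is_gcd [set k | u n k = u n 0%R] g & d %| g]].
have candidate_dvd n d : candidate n d -> d %| h.
  move=> [d_gt0 co_d [g [gS _] dg]].
  apply: (prodq_multiple_dvd_height minX height_h (Q_gt0 n) Xv d_gt0 (co_prodq n d co_d)).
  by move=> k /return_v/gS; exact: dvdn_trans.
have candidate_max n : exists d, is_level_height q u n d.
  have candidate1 : exists d, `[< candidate n d >].
    exists 1%N; apply/asboolP; split=> // [N _|]; first exact: coprime1n.
    by have [g gS] := is_gcd_exists [set k | u n k = u n 0%R]; exists g.
  have candidate_le d : `[< candidate n d >] -> d <= h.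
    by move=> /asboolP/candidate_dvd; exact: dvdn_leq.
  case: (ex_maxnP candidate1 candidate_le) => d /asboolP dn d_max.
  by exists d; split=> // e en; apply: d_max; apply/asboolP.
have [hn hnP] := choice candidate_max.
have hn_le n : hn n <= h by apply: dvdn_leq => //; apply: candidate_dvd (hnP n).1.
exists hn => //; split; last by move=> _ [n _ <-].
have [n hS] := height_dvd_prodq_multiples minX height_h Q_unb Xv.
(* At this level [h] is itself a candidate, so the bound [hn n <= h] is attained. *)
exists n => //; apply/eqP; rewrite eqn_leq hn_le /=; apply: (hnP n).2; split=> //.
have [g gS] := is_gcd_exists [set k | u n k = u n 0%R]; exists g => //.
by apply: gS.2 => k /return_v/hS.
Qed.
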